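(* Let $G$ be a finite abelian group, and let $\rho\ge 4$ be an integer. Then $\mathbf{s}_\rho(G)\le\frac32\rho^{-1}|G|$, and equality holds if and only if $G$ has a subgroup $H$ such that $G/H$ is cyclic of order $2\rho$. Indeed, for a subset $A\subseteq G$ the following assertions are equivalent: (i) $A$ is a generating set for $G$ satisfying $\operatorname{diam}_A(G)\ge\rho$ and $|A|=\frac32\rho^{-1}|G|$; (ii) $A=(-g+H)\cup H\cup(g+H)$, where $H$ is a subgroup of $G$ such that $G/H$ is cyclic of order $2\rho$, and $g$ is an element of $G$ such that $g+H$ is a generator of $G/H$.
   Context: For a subset $A$ of a finite abelian group $G$ (written additively) put $A^\pm:=(-A)\cup\{0\}\cup A$, and for an integer $\rho\ge 0$ let $\langle A\rangle_\rho:=\{a_1+\dotsb+a_\rho: a_i\in A^\pm\}$ (with $\langle A\rangle_0=\{0\}$). The diameter of $G$ with respect to $A$ is $\operatorname{diam}_A(G):=\min\{\rho\ge 0:\langle A\rangle_\rho=G\}$, with $\min\varnothing=\infty$. For a positive integer $\rho$ define, with the convention $\max\varnothing=0$, $\mathbf{s}_\rho(G):=\max\{|A|: A\subseteq G,\ \rho\le\operatorname{diam}_A(G)<\infty\}$. *)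

(* Defs.v *)
From HB Require Import structures.
From mathcomp Require Import all_boot all_order all_algebra all_fingroup all_solvable.

Set Implicit Arguments.
Unset Strict Implicit.
Unset Printing Implicit Defensive.

Import GroupScope.

(* Abelian groups are written multiplicatively, as everywhere in fingroup: the
   opposite of A is A^-1 and the setwise power S ^+ r is the set of all
   products of r elements of S. *)

Definition sym_set (gT : finGroupType) (A : {set gT}) : {set gT} :=
  A^-1 :|: [set 1] :|: A.

Definition ball (gT : finGroupType) (A : {set gT}) (r : nat) : {set gT} :=
  sym_set A ^+ r.

Lemma mem_ball (gT : finGroupType) (A : {set gT}) (r : nat) (x : gT) :
  reflect (exists2 a : 'I_r -> gT, forall i, a i \in sym_set A
             & x = \prod_(i < r) a i)
          (x \in ball A r).
Proof.
have -> : ball A r = \prod_(i < r) sym_set A.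
  by elim: r => [|r IHr]; rewrite /ball ?big_ord0 // big_ord_recl expgS -IHr.
by apply: (iffP prodsgP) => [[a Aa ->]|[a Aa ->]]; exists a => // i; apply: Aa.
Qed.

Lemma ball_covers_dec (gT : finGroupType) (G : {group gT}) (A : {set gT}) :
  decidable (exists r, ball A r == G).
Proof.
have VA: A^-1 \subset <<A>> by rewrite -genV subset_gen.
case: (boolP ((G :==: 1) || (<<A>> == G))) => [h|h]; [left | right].
  case/orP: h => [/eqP-> | /eqP <-]; first by exists 0; rewrite /ball expg0.
  have [n En] := gen_expgs (A^-1 :|: A).
  exists n; rewrite /ball /sym_set setUAC setUC -En eqEsubset !gen_subG.
  rewrite subUset VA subset_gen /=.
  by rewrite (subset_trans (subsetUr _ _) (subset_gen _)).
case=> -[|r] /eqP Er; case/norP: h => /eqP G1 /eqP AG.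
  by apply: G1; rewrite -Er /ball expg0.
have S1: 1 \in sym_set A by rewrite !inE eqxx orbT.
have sAS: A \subset sym_set A by apply: subsetUr.
have sAG: A \subset G.
  rewrite -Er; apply: subset_trans sAS _; rewrite /ball expgS.
  apply: mulg_subl; elim: r {Er} => [|r IHr]; first by rewrite expg0 set11.
  by rewrite expgS -(mulg1 1) mem_mulg.
apply: AG; apply/eqP; rewrite eqEsubset gen_subG sAG -Er.
have sSA: sym_set A \subset <<A>>.
  by rewrite !subUset VA subset_gen sub1G.
elim: r.+1 => [|m IHm]; first by rewrite /ball expg0 sub1G.
by rewrite /ball expgS mul_subG.
Qed.

(* None stands for the infinite diameter. *)
Definition diam (gT : finGroupType) (G : {group gT}) (A : {set gT}) :
    option nat :=
  if ball_covers_dec G A is left ex_r then Some (ex_minn ex_r) else None.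

Definition leq_diam (r : nat) (d : option nat) : bool :=
  if d is Some n then r <= n else true.

Definition s_max (gT : finGroupType) (r : nat) (G : {group gT}) : nat :=
  \max_(A : {set gT} |
      [&& A \subset G, leq_diam r (diam G A) & diam G A != None]) #|A|.

(* Main.v *)
Require Import Defs.
From HB Require Import structures.
From mathcomp Require Import all_boot all_order all_algebra all_fingroup all_solvable.
From mathcomp Require Import zify.

(** Write [S] for the symmetric set [sym_set A], so that the diameter is at
    least [rho] exactly when [S ^+ (rho - 1) != G]. The question is how
    large [S] can be when it generates [G] and [S ^+ (rho - 1)] misses a
    point.

    The proof uses the isoperimetric method of Mann and Hamidoune. The growth
    of [X] is [#|X * S| - #|X|], to be minimized over the nonempty [X] such
    that [X * S] is not all of [G]. Submodularity of [X |-> #|X * S|] shows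
    that two minimizers of least cardinality are equal or disjoint; as their
    left translates are again such minimizers, the one through [1] is a
    subgroup [H] ([subgroup_min_growth]). With [k := #|H * S| - #|H|], every
    step from [S ^+ j] to [S ^+ j.+1] short of [G] gains at least [k] points.
    Moreover, for [x] outside [S ^+ (rho - 1)] the sets [x *: S] and
    [S ^+ (rho - 2)] are disjoint, whence
    [#|G| >= 2 * #|S| + (rho - 3) * k] ([growth_diam]).

    The last ingredient is that [H * S] contains at least three cosets of
    [H] ([three_lcosets]): otherwise [H * S] would be a subgroup, and it
    would be all of [G]. Thus [3 * #|H| <= #|H * S|], so that
    [3 * k >= 2 * #|H * S| >= 2 * #|S|], and the previous inequality becomes
    [3 * #|G| >= 2 * rho * #|S|].

    When equality holds and [rho > 3], all of these are equalities: [S] is a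
    union of exactly three cosets of [H], which has index [2 * rho]. The two
    nontrivial cosets are exchanged by inversion, since otherwise they would
    be involutions generating [G / H], whose order would be at most [4]; thus
    [S = g^-1 *: H :|: H :|: g *: H] and the coset of [g] generates [G / H]
    ([extremal_cosets]). Conversely, for such a set the [j]-th power meets at
    most [2 * j + 1] cosets of [H], fewer than [2 * rho] for [j = rho - 1]
    ([ball_three_cosets_neq]). *)

Set Implicit Arguments.
Unset Strict Implicit.
Unset Printing Implicit Defensive.

Import GroupScope.

(** * Subgroups of minimal growth *)

Lemma expg_subG (gT : finGroupType) (G : {group gT}) (S : {set gT}) j :
  S \subset G -> S ^+ j \subset G.
Proof.
by move=> sSG; elim: j => [|j IHj]; rewrite ?expg0 ?sub1G // expgS mul_subG.
Qed.

Section Growth.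

Variables (gT : finGroupType) (G : {group gT}) (S : {set gT}).
Hypotheses (sSG : S \subset G) (VS : S^-1 = S) (S1 : 1 \in S).
Implicit Types X Y : {set gT}.

Definition nonfilling X := [&& X \subset G, X != set0 & X * S != G].

Definition growth X := #|X * S| - #|X|.

Lemma card_mul_growth X : #|X * S| = #|X| + growth X.
Proof. by rewrite subnKC // subset_leq_card // mulg_subl. Qed.

Lemma nonfillingS X Y :
  Y \subset X -> Y != set0 -> nonfilling X -> nonfilling Y.
Proof.
move=> sYX Y0 /and3P[sXG _ XSG]; rewrite /nonfilling Y0 (subset_trans sYX sXG).
apply: contraNneq XSG => YSG.
by rewrite eqEsubset mul_subG //= -{1}YSG mulSg.
Qed.

Lemma nonfilling_lcoset x X : x \in G -> nonfilling X -> nonfilling (x *: X).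
Proof.
move=> Gx /and3P[sXG X0 XSG]; rewrite /nonfilling -mulgA.
rewrite -card_gt0 card_lcoset card_gt0 X0 -(lcoset_id Gx) lcosetS sXG.
by rewrite (inj_eq (@lcoset_inj gT x)).
Qed.

Lemma growth_lcoset x X : growth (x *: X) = growth X.
Proof. by rewrite /growth -mulgA !card_lcoset. Qed.

Lemma growth_submodular X Y :
  #|(X :&: Y) * S| + #|(X :|: Y) * S| <= #|X * S| + #|Y * S|.
Proof.
rewrite mulUg -[leqRHS]cardsUI addnC leq_add2l subset_leq_card //.
by rewrite subsetI !mulSg ?subsetIl ?subsetIr.
Qed.

(** Since [S] is symmetric, [(G :\: X * S) * S] stays away from [X]. This
    duality handles the pairs of sets whose union fills [G], where
    submodularity alone does not conclude. *)
Lemma nonfilling_compl X : nonfilling X ->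
  nonfilling (G :\: X * S) /\ growth (G :\: X * S) <= growth X.
Proof.
case/and3P=> sXG X0 XSG; set D := G :\: X * S.
have sXSG : X * S \subset G by rewrite mul_subG.
have sDSX : D * S \subset G :\: X.
  apply/subsetP=> _ /mulsgP[d s /setDP[Gd XSd] Ss ->].
  rewrite inE groupM ?(subsetP sSG s) // andbT.
  apply: contra XSd => Xds; apply/mulsgP; exists (d * s) s^-1 => //.
    by rewrite -VS mem_invg invgK.
  by rewrite mulgK.
have cD : #|D| + #|X * S| = #|G|.
  by rewrite addnC -[in LHS](setIidPr sXSG) cardsID.
have cDS : #|D * S| + #|X| <= #|G|.
  by rewrite -(cardsID X G) (setIidPr sXG) addnC leq_add2l subset_leq_card.
split; last first.
  move: cD cDS; rewrite !card_mul_growth => <-.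
  by rewrite -addnA leq_add2l addnC leq_add2l.
rewrite /nonfilling subsetDl /= -card_gt0; apply/andP; split.
  have : #|X * S| < #|G| by apply: proper_card; rewrite properEneq XSG.
  by rewrite -cD addnC -[ltnLHS]addn0 ltn_add2l.
apply: contraNneq X0 => DSG; rewrite -cards_eq0.
by move: cDS; rewrite DSG -[leqRHS]addn0 leq_add2l leqn0.
Qed.

Definition min_growth X :=
  nonfilling X /\ forall Y, nonfilling Y -> growth X <= growth Y.

Definition atom X :=
  min_growth X /\ forall Y, min_growth Y -> #|X| <= #|Y|.

Lemma atom_exists : S != G :> {set gT} -> exists X, atom X.
Proof.
move=> SG; have n1 : nonfilling [set 1].
  by rewrite /nonfilling sub1set group1 mul1g SG -card_gt0 cards1.
have [X0 nX0 minX0] := @arg_minnP _ [set 1] nonfilling growth n1.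
pose P X := nonfilling X && (growth X == growth X0).
have PX0 : P X0 by rewrite /P nX0 eqxx.
have Pmin X : P X <-> min_growth X.
  split=> [/andP[nX /eqP gX]|[nX mX]]; last first.
    by rewrite /P nX eqn_leq mX //= minX0.
  by split=> // Y nY; rewrite gX minX0.
have [X PX minX] := @arg_minnP _ X0 P (fun X => #|X|) PX0.
by exists X; split=> [|Y /Pmin/minX //]; apply/Pmin.
Qed.

Lemma atom_lcoset x X : x \in G -> atom X -> atom (x *: X).
Proof.
move=> Gx [[nX mX] aX]; split=> [|Y]; rewrite ?card_lcoset; last exact: aX.
by split=> [|Y]; rewrite ?growth_lcoset; [apply: nonfilling_lcoset | apply: mX].
Qed.

(** If the union of [X] and [Y] is nonfilling, submodularity makes their
    intersection a minimizer, so it cannot be smaller than [X]. If the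
    union fills [G], the same inequality shows that [X] is larger than
    [G :\: X * S], which is a minimizer too: this contradicts the choice
    of [X]. *)
Lemma atomI_eq X Y : atom X -> atom Y -> X :&: Y != set0 -> X = Y.
Proof.
move=> aX aY XY0.
have [[nX mX] cX] := aX; have [[nY mY] cY] := aY.
have gXY : growth X = growth Y by apply/eqP; rewrite eqn_leq mX ?mY.
have cXY : #|X| = #|Y| by apply/eqP; rewrite eqn_leq cX ?cY //; split.
have nI : nonfilling (X :&: Y) by apply: nonfillingS nX => //; apply: subsetIl.
have gI := mX _ nI.
have sub := growth_submodular X Y; have cUI := cardsUI X Y.
have mI : min_growth (X :&: Y).
  split=> // Z /mX; apply: leq_trans.
  case: (boolP (nonfilling (X :|: Y))) => [/mX gU|].
    by move: sub gU cUI; rewrite !card_mul_growth -gXY; clear; lia.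
  have sUG : X :|: Y \subset G.
    by have [/and3P[sXG _ _] /and3P[sYG _ _]] := (nX, nY); rewrite subUset sXG.
  have U0 : X :|: Y != set0.
    apply: contraNneq XY0 => U0; rewrite -subset0 -U0.
    by rewrite (subset_trans (subsetIl _ _)) ?subsetUl.
  rewrite /nonfilling sUG U0 negbK => /eqP UG.
  have [nD gD] := nonfilling_compl nX; set D := G :\: X * S in nD gD.
  have mD : min_growth D by split=> // W /mX; apply: leq_trans.
  have sXSG : X * S \subset G by case/and3P: nX => sXG _ _; rewrite mul_subG.
  have cD : #|D| + #|X * S| = #|G|.
    by rewrite addnC -[in LHS](setIidPr sXSG) cardsID.
  (* [#|X| <= #|D|] is incompatible with [sub]; the cardinals are abstracted so
     that their convertible instances become identical for [lia]. *)
  have := cX _ mD; move: sub cD XY0; rewrite UG -card_gt0 !card_mul_growth -gXY.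
  by move: gI cXY; move: #|X :&: Y| #|G| #|X| #|Y| #|D| => *; lia.
have sIX : X \subset X :&: Y.
  by have /eqP-> : X :&: Y == X by rewrite eqEcard subsetIl cX.
apply/eqP; rewrite eqEcard -cXY leqnn andbT.
exact: subset_trans sIX (subsetIr _ _).
Qed.

(** For [x \in X], the atom [x *: X] shares the point [x] with [X], so it is
    [X]. *)
Lemma atom1_group_set X : atom X -> 1 \in X -> group_set X.
Proof.
move=> aX X1; apply/group_setP; split=> // x y Xx Xy.
have sXG : X \subset G by case: aX => [[/and3P[]]].
suff <- : x *: X = X by rewrite mem_lcoset mulKg.
apply: atomI_eq => //; first by apply: atom_lcoset => //; apply: (subsetP sXG).
by apply/set0Pn; exists x; rewrite inE mem_lcoset mulVg X1.
Qed.

Lemma subgroup_min_growth : S != G :> {set gT} ->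
  exists H : {group gT}, min_growth H.
Proof.
move=> /atom_exists[X aX]; have [[/and3P[sXG /set0Pn[x Xx] _] _] _] := aX.
have Gx : x^-1 \in G by rewrite groupV (subsetP sXG).
have aY := atom_lcoset Gx aX.
have gY : group_set (x^-1 *: X).
  by apply: atom1_group_set; rewrite // mem_lcoset invgK mulg1.
by exists (Group gY); case: aY.
Qed.

End Growth.

(** * Generating sets with large diameter *)

Lemma card_three_lcosets (gT : finGroupType) (H : {group gT}) (a b : gT) :
  a \notin H -> b \notin H -> a^-1 * b \notin H ->
  #|H :|: a *: H :|: b *: H| = (3 * #|H|)%N.
Proof.
move=> Ha Hb Hab.
have disj x y : x^-1 * y \notin H -> x *: H :&: y *: H = set0.
  move=> Hxy; apply/setP=> z; rewrite inE !mem_lcoset in_set0.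
  apply: contraNF Hxy => /andP[Hxz Hyz].
  have -> : x^-1 * y = x^-1 * z * (y^-1 * z)^-1.
    by rewrite invgM invgK mulgA mulgK.
  by rewrite groupM ?groupV.
have := disj 1 a; have := disj 1 b; have := disj a b; rewrite invg1 !mul1g.
move=> /(_ Hab) dab /(_ Hb) d1b /(_ Ha) d1a.
rewrite !cardsU setIUl d1a d1b dab setU0 !cards0 !subn0 !card_lcoset.
by rewrite !mulSn addn0 addnA.
Qed.

(** Here [s = #|S|], [h = #|H|], [p = #|H * S|], [k] is the growth of [H], [g]
    is the order of [G], and [r = rho - 4]. The first three hypotheses
    give [2 * s <= 3 * k]; equality in the conclusion forces
    [2 * s = 3 * k], hence [s = p = 3 * h], because the factor
    [r.+1 = rho - 3] is positive. *)
Lemma growth_arith (r p s k h g : nat) :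
    s <= p -> p = h + k -> 3 * h <= p -> s + (s + r.+1 * k) <= g ->
  (2 * r.+4 * s <= 3 * g)%N /\
  ((2 * r.+4 * s)%N = (3 * g)%N ->
    [/\ p = s, s = (3 * h)%N & g = (2 * r.+4 * h)%N]).
Proof.
move=> sp pE h3 gE.
have e0 : 2 * s <= 3 * k by move: sp pE h3; clear; lia.
have e1 : r.+1 * (2 * s) <= r.+1 * (3 * k) by rewrite leq_mul2l e0 orbT.
have e2 : 3 * (2 * s) + r.+1 * (3 * k) <= 3 * g.
  by rewrite (mulnCA r.+1) -mulnDr leq_mul2l mul2n -addnn -addnA gE.
have eL : (2 * r.+4 * s = 3 * (2 * s) + r.+1 * (2 * s))%N.
  by rewrite -mulnDl mulnCA mulnA.
rewrite eL; split=> [|E]; first by apply: leq_trans e2; rewrite leq_add2l.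
have e3 : 3 * k <= 2 * s.
  by rewrite -(leq_pmul2l (ltn0Sn r)); move: e2; rewrite -E leq_add2l.
have [ps s3] : p = s /\ s = (3 * h)%N by move: sp pE h3 e3; clear; lia.
split=> //.
by apply/eqP; rewrite -(eqn_pmul2l (isT : 0 < 3)) -E -eL s3 mulnCA.
Qed.

Section Diameter.

Variables (gT : finGroupType) (G : {group gT}) (S : {set gT}).
Hypotheses (abG : abelian G) (genS : <<S>> = G).
Hypotheses (VS : S^-1 = S) (S1 : 1 \in S).

Let sSG : S \subset G. Proof. by rewrite -genS subset_gen. Qed.

Lemma expg_neqS j : S ^+ j.+1 != G -> S ^+ j != G.
Proof.
apply: contraNneq => E.
by rewrite expgSr E eqEsubset mul_subG //= mulg_subl.
Qed.

(** If [s * t \notin H * S], the cosets of [1], [s^-1] and [t] are distinct,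
    and they lie in [H * S]. If there is no such pair, then [H * S] is
    closed under products, and is thus the group [<<S>>]. *)
Lemma three_lcosets (H : {group gT}) : H \subset G -> H * S != G ->
  exists a b, [/\ a \in S, b \in S, a \notin H, b \notin H & a^-1 * b \notin H].
Proof.
move=> sHG; have sGNH : G \subset 'N(H) by apply: sub_abelian_norm.
have cHS : commute S H by apply: normC; apply: subset_trans sGNH.
have sSHS : S \subset H * S by apply: mulg_subr.
case: (boolP (S * S \subset H * S)) => [sSS|]; last first.
  case/subsetPn=> _ /mulsgP[s t Ss St ->] HSst; exists s^-1, t; rewrite invgK.
  have sHHS : H \subset H * S by apply: mulg_subl.
  have Hst : s * t \notin H by apply: contra HSst; apply: (subsetP sHHS).
  split=> //; first by rewrite -VS mem_invg invgK.
    by rewrite groupV; apply: contra HSst => Hs; apply: mem_mulg.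
  by apply: contra HSst => Ht; rewrite -cHS; apply: mem_mulg.
have gHS : group_set (H * S).
  apply/group_setP; split=> [|x y HSx HSy]; first exact: (subsetP sSHS).
  suff: x * y \in H * S * (H * S).
    rewrite mulgA -(mulgA H S H) cHS mulgA mulGid -mulgA.
    by move/(subsetP (mulgS H sSS)); rewrite mulgA mulGid.
  exact: mem_mulg.
case/eqP; apply/eqP; rewrite eqEsubset mul_subG //=.
by rewrite -genS -[H * S]/(gval (Group gHS)) gen_subG.
Qed.

Lemma growth_expg (H : {group gT}) j : min_growth G S H -> S ^+ j.+1 != G ->
  #|S| + j * growth S H <= #|S ^+ j.+1|.
Proof.
move=> [_ mH]; elim: j => [|j IHj] SjG; first by rewrite expg1 addn0.
have nSj : nonfilling G S (S ^+ j.+1).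
  rewrite /nonfilling expg_subG // -expgSr SjG andbT; apply/set0Pn; exists 1.
  elim: (j.+1) => [|i IHi]; first by rewrite expg0 set11.
  by rewrite expgS -(mulg1 1) mem_mulg.
have {}IHj := IHj (expg_neqS SjG).
rewrite expgSr card_mul_growth // mulSn addnCA addnC.
by rewrite leq_add // mH.
Qed.

(** A point [x] outside [S ^+ r.+2] makes [x *: S] disjoint from [S ^+ r.+1]. *)
Lemma growth_diam (H : {group gT}) r : min_growth G S H -> S ^+ r.+2 != G ->
  #|S| + (#|S| + r * growth S H) <= #|G|.
Proof.
move=> mH SrG.
apply: leq_trans (leq_add (leqnn _) (growth_expg mH (expg_neqS SrG))) _.
have /subsetPn[x Gx Srx] : ~~ (G \subset S ^+ r.+2).
  by apply: contraNN SrG => sGS; rewrite eqEsubset expg_subG.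
have d : x *: S :&: S ^+ r.+1 = set0.
  apply/setP=> y; rewrite inE in_set0 mem_lcoset.
  apply: contraNF Srx => /andP[Sxy Sy].
  rewrite expgSr; apply/mulsgP; exists y (x^-1 * y)^-1 => //.
    by rewrite -VS mem_invg invgK.
  by rewrite invgM invgK mulKVg.
rewrite -(card_lcoset S x) -cardsUI d cards0 addn0 subset_leq_card //.
by rewrite subUset expg_subG // mul_subG ?sub1set.
Qed.

Lemma expg_neq_bound rho : 3 < rho -> S ^+ rho.-1 != G ->
  (2 * rho * #|S| <= 3 * #|G|)%N /\
  ((2 * rho * #|S|)%N = (3 * #|G|)%N -> exists H : {group gT},
     [/\ H \subset G, S * H = S, #|S| = (3 * #|H|)%N
       & #|G| = (2 * rho * #|H|)%N]).
Proof.
case: rho => [|[|[|[|r]]]] // _ /= SrG.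
have SG : S != G.
  rewrite -[S]expg1; elim: (r.+2) SrG => [//|i IHi] SiG.
  exact: IHi (expg_neqS SiG).
have [H mH] := subgroup_min_growth sSG VS S1 SG.
have [/and3P[sHG _ HSG] _] := mH.
have [a [b [Sa Sb Ha Hb Hab]]] := three_lcosets sHG HSG.
have cHS : S * H = H * S by apply/normC/(subset_trans sSG)/sub_abelian_norm.
have cU := card_three_lcosets Ha Hb Hab.
have sU : H :|: a *: H :|: b *: H \subset H * S.
  by rewrite -cHS !subUset mulg_subr // !mulSg ?sub1set.
have {cU sU} h3 : 3 * #|H| <= #|H * S| by rewrite -cU subset_leq_card.
have sSHS : #|S| <= #|H * S| by rewrite subset_leq_card // mulg_subr.
have gH := card_mul_growth S1 H.
have [le_s eq_s] := growth_arith sSHS gH h3 (growth_diam mH SrG).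
split=> // /eq_s[cS s3 g2]; exists H; split=> //.
by apply/esym/eqP; rewrite cHS eqEcard mulg_subr ?cS /=.
Qed.

(** Up to [H], the set [S] consists of [1], [a] and [b]. If [a] and [b] were
    both involutions modulo [H], the abelian group [G / H] would have
    order at most [4]; so some [g \in S] has a square outside [H], and
    then [g H] and [g^-1 H] are the two nontrivial cosets in [S]. *)
Lemma extremal_cosets rho (H : {group gT}) : 3 < rho -> H \subset G ->
    S * H = S -> #|S| = (3 * #|H|)%N -> #|G| = (2 * rho * #|H|)%N ->
  exists g, [/\ g \in G, generator (G / H) (coset H g)
             & S = g^-1 *: H :|: H :|: g *: H].
Proof.
move=> rho4 sHG SH cS cG.
have nHG : G \subset 'N(H) by apply: sub_abelian_norm.
have cHS : S * H = H * S by apply/normC/(subset_trans sSG).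
have cQ : #|G / H| = (2 * rho)%N.
  by rewrite card_quotient // -divgS // cG mulnK ?cardG_gt0.
have HSG : H * S != G.
  rewrite -cHS SH; apply: contraTneq rho4 => SG; rewrite -leqNgt.
  by move/eqP: cS; rewrite SG cG eqn_pmul2r ?cardG_gt0 //; clear; lia.
have [a [b [Sa Sb Ha Hb Hab]]] := three_lcosets sHG HSG.
have sS x : x \in S -> x *: H \subset S.
  by move=> Sx; rewrite -SH mulSg ?sub1set.
have sHS : H \subset S by rewrite -[gval H]mul1g sS.
have inG x : x \in S -> x \in G by apply: (subsetP sSG).
have genQ (K : {group coset_of H}) : S / H \subset K -> G / H \subset K.
  by rewrite -genS quotient_gen ?gen_subG // (subset_trans sSG).
have coset_lcoset x y : x \in G -> y \in x *: H -> coset H y = coset H x.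
  move=> Gx /lcosetP[h Hh ->].
  by rewrite morphM ?(subsetP nHG) // ?(subsetP sHG) //= (coset_id Hh) mulg1.
have defS : S = H :|: a *: H :|: b *: H.
  apply/esym/eqP; rewrite eqEcard !subUset sHS !sS //=.
  by rewrite cS card_three_lcosets.
have [g [Sg Hg Hgg]] : exists g, [/\ g \in S, g \notin H & g * g \notin H].
  case: (boolP (a * a \in H)) => [Haa | ?]; last by exists a.
  case: (boolP (b * b \in H)) => [Hbb | ?]; last by exists b.
  have abQ : abelian (G / H) by apply: quotient_abelian.
  have ord2 x : x \in S -> x * x \in H -> #|<[coset H x]>| <= 2.
    move=> Sx Hxx; apply: dvdn_leq => //; rewrite -/(#[_]) order_dvdn.
    by rewrite expgS expg1 -morphM ?(subsetP nHG) ?inG //= coset_id.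
  have QS x : x \in S -> coset H x \in G / H.
    by move=> Sx; rewrite mem_quotient ?inG.
  have cab : <[coset H b]> \subset 'C(<[coset H a]>).
    by apply: centSS abQ; rewrite cycle_subG QS.
  have sGab : G / H \subset <[coset H a]> <*> <[coset H b]>.
    apply: genQ; apply/subsetP=> _ /morphimP[x Nx Sx ->] /=.
    move: Sx; rewrite defS !inE -orbA => /or3P[Hx | ax | bx].
    - by rewrite coset_id ?group1.
    - rewrite (coset_lcoset a) ?inG //.
      by rewrite (subsetP (joing_subl _ _)) ?cycle_id.
    - rewrite (coset_lcoset b) ?inG //.
      by rewrite (subsetP (joing_subr _ _)) ?cycle_id.
  have: #|G / H| <= 2 * 2.
    apply: leq_trans (subset_leq_card sGab) _.
    rewrite joingC cent_joinEl //.
    set I := <[coset H b]> :&: <[coset H a]>.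
    apply: leq_trans (leq_pmulr _ (cardG_gt0 I)) _.
    by rewrite -mul_cardG leq_mul ?ord2.
  by rewrite cQ leq_pmul2l // leqNgt (ltnW rho4).
have Gg := inG _ Sg.
have defS' : S = g^-1 *: H :|: H :|: g *: H.
  apply/esym/eqP; rewrite eqEcard !subUset sHS !sS //= -?mem_invg ?VS //=.
  by rewrite cS [_ :|: H]setUC card_three_lcosets ?groupV ?invgK.
exists g; split=> //.
rewrite /generator eqEsubset cycle_subG mem_quotient // andbT.
apply: genQ; apply/subsetP=> _ /morphimP[x Nx Sx ->] /=.
move: Sx; rewrite defS' !inE -orbA => /or3P[gx | Hx | gx].
- rewrite (coset_lcoset g^-1) ?groupV // morphV ?(subsetP nHG) //=.
  by rewrite groupV cycle_id.
- by rewrite coset_id ?group1.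
- by rewrite (coset_lcoset g) ?cycle_id.
Qed.

End Diameter.

(** * Balls and the diameter *)

Section Balls.

Variables (gT : finGroupType) (G : {group gT}) (A : {set gT}).

Lemma sym_setV : (sym_set A)^-1 = sym_set A.
Proof.
apply/setP=> x; rewrite mem_invg !inE invgK invg_eq1.
by rewrite orbC (orbC (x \in A)) orbA.
Qed.

Lemma sym_set1 : 1 \in sym_set A.
Proof. by rewrite !inE eqxx orbT. Qed.

Lemma sub_sym_set : A \subset sym_set A.
Proof. exact: subsetUr. Qed.

Lemma gen_sym_set : <<sym_set A>> = <<A>>.
Proof.
have VA : A^-1 \subset <<A>> by rewrite -genV subset_gen.
apply/eqP; rewrite eqEsubset andbC genS ?sub_sym_set //= gen_subG !subUset.
by rewrite VA sub1G subset_gen.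
Qed.

Lemma ball_sub r : A \subset G -> ball A r \subset G.
Proof.
move=> sAG; apply: expg_subG; apply: subset_trans (subset_gen _) _.
by rewrite gen_sym_set gen_subG.
Qed.

Lemma ball_mono m n : m <= n -> ball A m \subset ball A n.
Proof.
move=> /subnKC <-; elim: (n - m)%N => [|k IHk]; first by rewrite addn0.
by rewrite addnS /ball expgSr (subset_trans IHk) // mulg_subl // sym_set1.
Qed.

Lemma exists_ball_eq : A \subset G ->
  (exists r, ball A r == G) <-> <<A>> = G.
Proof.
move=> sAG; split=> [[r /eqP Er] | gA].
  apply/eqP; rewrite eqEsubset gen_subG sAG -{1}Er /=.
  have sSA : sym_set A \subset <<A>> by rewrite -gen_sym_set subset_gen.
  exact: expg_subG.
have [n En] := gen_expgs (sym_set A); exists n.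
by rewrite -gA -gen_sym_set En (setUidPr _) // sub1set sym_set1.
Qed.

Lemma diam_finiteP : A \subset G -> diam G A != None <-> <<A>> = G.
Proof.
move=> /exists_ball_eq <-; rewrite /diam.
by case: ball_covers_dec => [ex|nex]; split=> // /nex.
Qed.

Lemma leq_diamE r : A \subset G ->
  leq_diam r.+1 (diam G A) = (ball A r != G).
Proof.
move=> sAG; rewrite /diam; case: ball_covers_dec => [ex|nex] /=; last first.
  by apply/esym/negP => Er; apply: nex; exists r.
case: ex_minnP => m /eqP Em min_m; apply/idP/idP => [lt_rm | Er].
  by apply: contraL lt_rm => /min_m; rewrite -leqNgt.
rewrite ltnNge; apply: contra Er => le_mr.
by rewrite eqEsubset ball_sub // -Em ball_mono.
Qed.

End Balls.

(** * Three consecutive cosets in a cyclic quotient *)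

Section CyclicQuotient.

Variables (gT : finGroupType) (G H : {group gT}) (g : gT) (rho : nat).
Hypotheses (abG : abelian G) (sHG : H \subset G) (Gg : g \in G).
Hypotheses (cQ : #|G / H| = (2 * rho)%N).
Hypotheses (genQ : generator (G / H) (coset H g)).

Local Notation A := (g^-1 *: H :|: H :|: g *: H).
Local Notation c := (coset H g).

Let nHG x : x \in G -> x \in 'N(H).
Proof. by apply/subsetP/sub_abelian_norm. Qed.

Let ord_c : #[c] = (2 * rho)%N.
Proof. by rewrite -cQ (eqP genQ). Qed.

Lemma sub_three_cosets : A \subset G.
Proof. by rewrite !subUset sHG !mul_subG ?sub1set ?groupV. Qed.

Lemma card_G_three_cosets : #|G| = (2 * rho * #|H|)%N.
Proof.
rewrite -cQ card_quotient; last exact/subsetP.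
by rewrite mulnC Lagrange.
Qed.

Lemma card_three_cosets : 1 < rho -> #|A| = (3 * #|H|)%N.
Proof.
move=> rho1; have notH k : 0 < k < 2 * rho -> g ^+ k \notin H.
  case/andP=> k0 k2; apply/negP=> /coset_id; rewrite morphX ?nHG //= => /eqP.
  by rewrite -order_dvdn ord_c => /(dvdn_leq k0); rewrite leqNgt k2.
rewrite [_ :|: H]setUC card_three_lcosets ?groupV //.
- by rewrite -(expg1 g) notH //; clear -rho1; lia.
- by rewrite -(expg1 g) notH //; clear -rho1; lia.
- by rewrite invgK -[g * g]/(g ^+ 2) notH //; clear -rho1; lia.
Qed.

Lemma gen_three_cosets : <<A>> = G.
Proof.
have sHA : H \subset <<A>>.
  by apply: subset_trans (subset_gen _); rewrite setUAC subsetUr.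
apply/eqP; rewrite eqEsubset gen_subG sub_three_cosets.
rewrite -(quotientSGK _ sHA); last exact/subsetP.
rewrite (eqP genQ) cycle_subG mem_quotient // mem_gen //.
by rewrite in_setU (mem_lcoset _ g g) mulVg group1 orbT.
Qed.

(** Modulo [H] a point of the ball is [c ^+ i] with [- k <= i <= k]; the
    factor [c ^+ k] shifts these exponents to natural numbers. *)
Lemma ball_three_cosets k x : x \in ball A k ->
  exists2 j, j <= k.*2 & coset H x * c ^+ k = c ^+ j.
Proof.
have cosetc y z : y \in G -> z \in y *: H ->
    z \in G /\ coset H z = coset H y.
  move=> Gy /lcosetP[h Hh ->]; have Gh := subsetP sHG h Hh.
  by rewrite groupM // morphM ?nHG //= (coset_id Hh) mulg1.
have cA z : z \in A -> z \in G /\ coset H z \in [set c^-1; 1; c].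
  rewrite !inE -!orbA => /or3P[/cosetc | Hz | /cosetc].
  - by rewrite groupV => /(_ Gg)[-> ->]; rewrite morphV ?nHG //= eqxx.
  - by rewrite (subsetP sHG) // coset_id // eqxx orbT.
  - by move=> /(_ Gg)[-> ->]; rewrite eqxx !orbT.
have cS z : z \in sym_set A -> z \in G /\ coset H z \in [set c^-1; 1; c].
  rewrite in_setU in_setU mem_invg in_set1 -orbA.
  case/or3P=> [/cA | /eqP-> | /cA //].
    rewrite groupV => -[Gz]; rewrite morphV ?nHG //= !inE -orbA.
    case/or3P=> /eqP/(canRL invgK)->; split=> //;
    by rewrite ?invgK ?invg1 eqxx ?orbT.
  by rewrite group1 morph1 !inE eqxx orbT.
have cSc z : z \in sym_set A ->
    z \in G /\ exists2 e, e <= 2 & coset H z * c = c ^+ e.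
  case/cS=> Gz; rewrite !inE -orbA => cz; split=> //.
  case/or3P: cz => /eqP->.
  - by exists 0; rewrite // mulVg.
  - by exists 1%N; rewrite // mul1g.
  - by exists 2.
rewrite /ball; elim: k x => [|k IHk] x.
  by rewrite expg0 => /set1P->; exists 0; rewrite // morph1 mulg1.
rewrite expgS => /mulsgP[s y /cSc[Gs [e le_e Es]] By ->].
have [j le_j Ej] := IHk y By.
have Gy : y \in G by apply: (subsetP (ball_sub k sub_three_cosets)).
exists (e + j)%N; first by rewrite doubleS -addn2 addnC leq_add.
rewrite morphM ?nHG //= expgSr -mulgA (mulgA (coset H y)) Ej -expgSr expgS.
by rewrite mulgA Es expgD.
Qed.

Lemma ball_three_cosets_neq : 0 < rho -> ball A rho.-1 != G.
Proof.
move=> rho0; apply/eqP=> EB.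
pose f (j : 'I_(rho.-1).*2.+1) := c ^+ j * c ^- rho.-1.
have sQ : G / H \subset [set f j | j in predT].
  apply/subsetP=> _ /morphimP[x Nx Gx ->].
  have [|j le_j Ej] := @ball_three_cosets rho.-1 x; first by rewrite EB.
  apply/imsetP; exists (Ordinal (le_j : j < _.+1)) => //.
  by rewrite /f /= -Ej mulgK.
have := leq_trans (subset_leq_card sQ) (leq_imset_card _ _).
by rewrite cQ card_ord; clear -rho0; lia.
Qed.

End CyclicQuotient.

(** * Sets of maximal size *)

Section Main.

Variables (gT : finGroupType) (G : {group gT}) (rho : nat).
Hypotheses (abG : abelian G) (rho_ge4 : 4 <= rho).

(** The bound holds for [sym_set A], which contains [A]; so equality for [A]
    forces [A = sym_set A]. *)
Lemma card_large_diam (A : {set gT}) : A \subset G -> <<A>> = G ->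
    leq_diam rho (diam G A) ->
  (2 * rho * #|A| <= 3 * #|G|)%N /\
  ((2 * rho * #|A|)%N = (3 * #|G|)%N -> exists H : {group gT}, exists g : gT,
    [/\ [/\ H \subset G, cyclic (G / H) & #|G / H| = (2 * rho)%N],
        g \in G, generator (G / H) (coset H g)
      & A = g^-1 *: H :|: H :|: g *: H]).
Proof.
move=> sAG gA dA.
have rhoS : rho = rho.-1.+1 by rewrite prednK ?(ltn_trans _ rho_ge4).
have neqG : sym_set A ^+ rho.-1 != G.
  by move: dA; rewrite rhoS leq_diamE //= -rhoS.
have gS : <<sym_set A>> = G by rewrite gen_sym_set.
have [le3 eq3] := expg_neq_bound abG gS (sym_setV A) (sym_set1 A) rho_ge4 neqG.
have leA : #|A| <= #|sym_set A| by rewrite subset_leq_card ?sub_sym_set.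
split=> [|EA]; first by apply: leq_trans le3; rewrite leq_mul2l leA orbT.
have ES : #|A| = #|sym_set A|.
  apply/eqP; rewrite eqn_leq leA /= -(@leq_pmul2l (2 * rho)).
    by rewrite EA.
  by rewrite muln_gt0 (ltn_trans _ rho_ge4).
have defS : A = sym_set A by apply/eqP; rewrite eqEcard sub_sym_set ES /=.
have [|H [sHG SH cS cG]] := eq3; first by rewrite -ES.
have [g [Gg gen_g Sg]] :=
  extremal_cosets abG gS (sym_setV A) (sym_set1 A) rho_ge4 sHG SH cS cG.
exists H, g; split=> //; last by rewrite {1}defS.
split=> //; first by rewrite (eqP gen_g) cycle_cyclic.
by rewrite card_quotient ?sub_abelian_norm // -divgS // cG mulnK ?cardG_gt0 //.
Qed.

Lemma three_cosets_extremal (H : {group gT}) (g : gT) : H \subset G ->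
    g \in G -> #|G / H| = (2 * rho)%N -> generator (G / H) (coset H g) ->
  let A := g^-1 *: H :|: H :|: g *: H in
  [/\ A \subset G, <<A>> = G, leq_diam rho (diam G A)
    & (2 * rho * #|A|)%N = (3 * #|G|)%N].
Proof.
move=> sHG Gg cQ gen_g A.
have rho0 : 0 < rho by apply: ltn_trans rho_ge4.
have sAG : A \subset G by apply: sub_three_cosets.
split=> //; first exact: gen_three_cosets.
  by rewrite -(prednK rho0) leq_diamE // (ball_three_cosets_neq abG).
rewrite (card_three_cosets abG sHG Gg cQ) ?(ltn_trans _ rho_ge4) //.
by rewrite (card_G_three_cosets abG sHG cQ) mulnCA.
Qed.

End Main.

Section Bound.

Import Order.TTheory GRing.Theory Num.Theory.
Local Open Scope ring_scope.

Lemma bound_mul (rho n : nat) :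
  3%:R / 2%:R * rho%:R^-1 * n%:R = (3 * n)%N%:R / (2 * rho)%N%:R :> rat.
Proof. by rewrite !natrM invfM [RHS]mulrACA -[LHS]mulrA [n%:R * _]mulrC. Qed.

Lemma ler_bound (rho a n : nat) : (0 < rho)%N ->
  (a%:R <= 3%:R / 2%:R * rho%:R^-1 * n%:R :> rat) = (2 * rho * a <= 3 * n)%N.
Proof.
move=> rho0; rewrite bound_mul ler_pdivlMr ?ltr0n ?muln_gt0 //.
by rewrite -natrM ler_nat mulnC.
Qed.

Lemma eqr_bound (rho a n : nat) : (0 < rho)%N ->
  (a%:R = 3%:R / 2%:R * rho%:R^-1 * n%:R :> rat) <->
  (2 * rho * a = 3 * n)%N.
Proof.
move=> rho0; rewrite bound_mul (mulnC _ a).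
have nz : (2 * rho)%N%:R != 0 :> rat by rewrite pnatr_eq0 muln_eq0 -lt0n.
split=> E; last by rewrite -E natrM mulfK.
by apply/eqP; rewrite -(eqr_nat rat) natrM E divfK.
Qed.

End Bound.

Theorem theorem2p12 (gT : finGroupType) (G : {group gT}) (rho : nat)
    (abG : abelian G) (rho_ge4 : 4 <= rho) :
  let bound : rat := (3%:R / 2%:R * rho%:R^-1 * #|G|%:R)%R in
  [/\ ((s_max rho G)%:R <= bound)%R,
      ((s_max rho G)%:R = bound)%R <->
        (exists H : {group gT},
           [/\ H \subset G, cyclic (G / H) & #|G / H| = (2 * rho)%N])
    & forall A : {set gT}, A \subset G ->
        ([/\ <<A>> = G, leq_diam rho (diam G A) & (#|A|%:R)%R = bound] <->
         (exists H : {group gT}, exists g : gT,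
            [/\ [/\ H \subset G, cyclic (G / H) & #|G / H| = (2 * rho)%N],
                g \in G, generator (G / H) (coset H g)
              & A = (g^-1 *: H) :|: H :|: (g *: H)]))].
Proof.
have rho0 : 0 < rho by apply: ltn_trans rho_ge4.
move=> bound.
have s_le : 2 * rho * s_max rho G <= 3 * #|G|.
  rewrite /s_max; elim/big_ind: _ => [|m n le_m le_n|A].
  - by rewrite muln0.
  - by rewrite maxnMr geq_max le_m.
  case/and3P=> sAG dA /(diam_finiteP sAG) gA.
  by have [] := card_large_diam abG rho_ge4 sAG gA dA.
split.
- by rewrite ler_bound.
- rewrite eqr_bound //; split=> [Es | [H [sHG cQ oQ]]].
    have [A PA EA] : {A | A \in [pred A : {set gT} |
        [&& A \subset G, leq_diam rho (diam G A) & diam G A != None]]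
        & s_max rho G = #|A|}.
      apply: eq_bigmax_cond; rewrite lt0n; apply/negP=> /eqP/card0_eq P0.
      have := cardG_gt0 G; rewrite -(ltn_pmul2l (isT : 0 < 3)) -Es.
      by rewrite /s_max big_pred0 // !muln0.
    case/and3P: PA => sAG dA /(diam_finiteP sAG) gA.
    have [_] := card_large_diam abG rho_ge4 sAG gA dA.
    by case=> [|H [g [HP _ _ _]]]; [rewrite -EA | exists H].
  have [x defQ] := cyclicP cQ.
  have /morphimP[g Ng Gg xg] : x \in G / H by rewrite defQ cycle_id.
  have gen_g : generator (G / H) (coset H g) by rewrite /generator defQ xg.
  have [sAG gA dA EA] := three_cosets_extremal abG rho_ge4 sHG Gg oQ gen_g.
  apply/eqP; rewrite eqn_leq s_le /= -EA leq_mul2l; apply/orP; right.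
  apply: (@leq_bigmax_cond _ _ (fun A : {set gT} => #|A|)).
  by rewrite sAG dA /=; apply/(diam_finiteP sAG).
move=> A sAG; split=> [[gA dA /(eqr_bound _ _ rho0) EA] |].
  by have [_ exH] := card_large_diam abG rho_ge4 sAG gA dA; apply: exH.
case=> H [g [[sHG _ oQ] Gg gen_g ->]].
have [_ gA dA EA] := three_cosets_extremal abG rho_ge4 sHG Gg oQ gen_g.
by split=> //; apply/eqr_bound.
Qed.
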